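(* For all integers $j\geq 2$ and $n\geq 2$, \[ m_j(K_{1,2}, P_4, nK_2)\geq\left\lfloor \frac{2n}{j} \right\rfloor+1. \]
   Context: All graphs are finite, simple and undirected. $K_{j\times t}$ denotes the complete multipartite graph with $j$ partite classes, each of size $t$. For graphs $G_1,\dots,G_k$ and an integer $j$, $m_j(G_1,\dots,G_k)$ is the smallest positive integer $t$ such that every $k$-coloring of the edges of $K_{j\times t}$ contains, for some $i$, a copy of $G_i$ all of whose edges have color $i$. $K_{1,2}$ is the path on 3 vertices, $P_4$ the path on 4 vertices, and $nK_2$ the matching of $n$ disjoint edges. *)

(* Defs.v *)
From mathcomp Require Import all_boot.
From mathcomp Require Import classical_sets.

Set Implicit Arguments.
Unset Strict Implicit.
Unset Printing Implicit Defensive.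

Record sgraph := SGraph {
  vertex :> finType;
  adj : rel vertex;
  adj_sym : symmetric adj;
  adj_irr : irreflexive adj
}.

Definition cmultipartite_rel (j t : nat) : rel ('I_j * 'I_t)%type :=
  fun x y => x.1 != y.1.

Fact cmultipartite_sym j t : symmetric (@cmultipartite_rel j t).
Proof. by move=> x y; rewrite /cmultipartite_rel eq_sym. Qed.

Fact cmultipartite_irr j t : irreflexive (@cmultipartite_rel j t).
Proof. by move=> x; rewrite /cmultipartite_rel eqxx. Qed.

(* K_{j x t}: the vertex (i, a) is the a-th element of the i-th class. *)
Definition cmultipartite (j t : nat) : sgraph :=
  SGraph (@cmultipartite_sym j t) (@cmultipartite_irr j t).

Definition cbipartite_rel (a b : nat) : rel ('I_a + 'I_b)%type :=
  fun x y => match x, y with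
             | inl _, inr _ | inr _, inl _ => true
             | _, _ => false
             end.

Fact cbipartite_sym a b : symmetric (@cbipartite_rel a b).
Proof. by move=> [?|?] [?|?]. Qed.

Fact cbipartite_irr a b : irreflexive (@cbipartite_rel a b).
Proof. by move=> [?|?]. Qed.

Definition cbipartite (a b : nat) : sgraph :=
  SGraph (@cbipartite_sym a b) (@cbipartite_irr a b).

Definition path_rel (n : nat) : rel 'I_n :=
  fun x y => (x.+1 == y :> nat) || (y.+1 == x :> nat).

Fact path_sym n : symmetric (@path_rel n).
Proof. by move=> x y; rewrite /path_rel orbC. Qed.

Fact path_irr n : irreflexive (@path_rel n).
Proof. by move=> x; rewrite /path_rel orbb gtn_eqF. Qed.

(* P_n, the path on n vertices (not n edges). *)
Definition path_graph (n : nat) : sgraph :=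
  SGraph (@path_sym n) (@path_irr n).

Definition matching_rel (n : nat) : rel ('I_n * bool)%type :=
  fun x y => (x.1 == y.1) && (x.2 != y.2).

Fact matching_sym n : symmetric (@matching_rel n).
Proof.
by move=> x y; rewrite /matching_rel eq_sym [x.2 == _]eq_sym.
Qed.

Fact matching_irr n : irreflexive (@matching_rel n).
Proof. by move=> x; rewrite /matching_rel !eqxx. Qed.

(* n K_2: the i-th edge joins (i, false) and (i, true). *)
Definition matching_graph (n : nat) : sgraph :=
  SGraph (@matching_sym n) (@matching_irr n).

(* A k-colouring of the edges of H is given by a function on all vertex sets
   of H, the edge xy being the set {x, y}; its values outside the edges of H
   are never used. *)
Definition coloring (k : nat) (H : sgraph) := {set H} -> 'I_k.

(* The copy need not be induced. *)
Definition has_mono_copy (k : nat) (H : sgraph) (c : coloring k H)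
    (G : sgraph) (i : 'I_k) : Prop :=
  exists2 f : G -> H, injective f &
    forall x y : G, adj x y -> adj (f x) (f y) /\ c [set f x; f y]%SET = i.

Definition arrows (k : nat) (H : sgraph) (Gs : 'I_k -> sgraph) : Prop :=
  forall c : coloring k H, exists i : 'I_k, has_mono_copy c (Gs i) i.

Definition is_multipartite_ramsey (j k : nat) (Gs : 'I_k -> sgraph)
    (t : nat) : Prop :=
  [/\ 0 < t, arrows (cmultipartite j t) Gs
    & forall s, 0 < s -> arrows (cmultipartite j s) Gs -> t <= s].

(* m_j(G_1, ..., G_k). If no t works the value is 0, so that any positive lower
   bound on it entails that m_j(G_1, ..., G_k) exists. *)
Definition multipartite_ramsey (j k : nat) (Gs : 'I_k -> sgraph) : nat :=
  xget 0 (fun t => is_multipartite_ramsey j Gs t).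

(* Colour 0 is paired with G1, colour 1 with G2, colour 2 with G3. *)
Definition graphs3 (G1 G2 G3 : sgraph) : 'I_3 -> sgraph :=
  fun i => match val i with 0 => G1 | 1 => G2 | _ => G3 end.

(* Main.v *)
Require Import Defs.
From mathcomp Require Import all_boot.
From mathcomp Require Import boolp.
From mathcomp Require Import zify.

Set Implicit Arguments.
Unset Strict Implicit.
Unset Printing Implicit Defensive.

(** Lower bound: if [j * t <= 2 * n], colour the edges at one fixed vertex [v]
    with colour 1 and all others with colour 2. Colour 1 is a star, hence has no
    [P_4], and colour 2 misses [v], so an [n K_2] would need [2 * n] vertices
    among at most [2 * n - 1].
    Existence of the Ramsey number: [K_{j x 3n}] contains [n] disjoint copies of
    [K_{3,3}]. If colour 0 has maximum degree 1 and colour 2 is absent from one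
    of them, colour 1 contains [P_4] there; otherwise every copy contributes one
    edge to a matching of colour 2. *)

Lemma mono_copy_cherry k (H : sgraph) (c : coloring k H) (i : 'I_k)
    (x y z : H) :
  adj x y -> adj x z -> y != z ->
  c [set x; y]%SET = i -> c [set x; z]%SET = i ->
  has_mono_copy c (cbipartite 1 2) i.
Proof.
move=> xy xz yz cxy cxz.
have nadj u w : u = w -> adj u w -> False by move=> ->; rewrite adj_irr.
exists (fun u : cbipartite 1 2 =>
  match u with inl _ => x | inr i => if i == ord0 then y else z end).
  case=> [p|p] [q|q]; rewrite ?(ord1 p) ?(ord1 q) //.
  - by case: ifP => _ /nadj; [case/(_ xy) | case/(_ xz)].
  - by case: ifP => _ /esym /nadj; [case/(_ xy) | case/(_ xz)].
  - case: p q => [[|[|//]] hp] [[|[|//]] hq] //= e;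
      rewrite ?e ?eqxx // in yz *; by congr inr; apply: val_inj.
have sym2 u : c [set u; x]%SET = c [set x; u]%SET by rewrite setUC.
by case=> [p|p] [q|q] //= _; rewrite ?sym2; case: ifP => _;
  split; rewrite // adj_sym.
Qed.

Lemma mono_copy_path4 k (H : sgraph) (c : coloring k H) (i : 'I_k)
    (w x y z : H) :
  uniq [:: w; x; y; z] -> adj w x -> adj x y -> adj y z ->
  c [set w; x]%SET = i -> c [set x; y]%SET = i -> c [set y; z]%SET = i ->
  has_mono_copy c (path_graph 4) i.
Proof.
move=> un wx xy yz cwx cxy cyz.
exists (fun p : path_graph 4 => nth w [:: w; x; y; z] p).
  by move=> p q /eqP; rewrite nth_uniq // => /eqP /val_inj.
by case=> [[|[|[|[|//]]]] hp] [[|[|[|[|//]]]] hq] //= _; split;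
  rewrite // 1?adj_sym // setUC.
Qed.

(** Without a cherry of colour 0, each vertex has at most one edge of colour 0 to the opposite side.
    If colour 2 were absent, at least two of its three edges would have colour 1, enough to walk
    along a [P_4]. *)
Lemma mono_copy_K33 (H : sgraph) (c : coloring 3 H) (a b : 'I_3 -> H) :
  injective a -> injective b -> (forall p q, adj (a p) (b q)) ->
  ~ has_mono_copy c (cbipartite 1 2) (inord 0) ->
  ~ has_mono_copy c (path_graph 4) (inord 1) ->
  exists p q, c [set a p; b q]%SET = inord 2.
Proof.
move=> inja injb ab no0 no1; apply: contrapT => no2.
have col p q : c [set a p; b q]%SET <> inord 0 -> c [set a p; b q]%SET = inord 1.
  have : c [set a p; b q]%SET <> inord 2 by move=> e; apply: no2; exists p, q.
  case: (c _) => [[|[|[|//]]] h] n2 n0; apply: val_inj; rewrite /= inordK //.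
    by case: n0; apply: val_inj; rewrite /= inordK.
  by case: n2; apply: val_inj; rewrite /= inordK.
have rowP p q q' : q != q' ->
    c [set a p; b q]%SET = inord 1 \/ c [set a p; b q']%SET = inord 1.
  move=> qq'; have [e|/col] := pselect (c [set a p; b q]%SET = inord 0);
    last by left.
  right; apply: col => e'; apply: no0.
  by apply: (@mono_copy_cherry _ _ _ _ (a p) (b q) (b q'));
    rewrite ?(inj_eq injb).
have colP q p p' : p != p' ->
    c [set a p; b q]%SET = inord 1 \/ c [set a p'; b q]%SET = inord 1.
  move=> pp'; have [e|/col] := pselect (c [set a p; b q]%SET = inord 0);
    last by left.
  right; apply: col => e'; apply: no0.
  by apply: (@mono_copy_cherry _ _ _ _ (b q) (a p) (a p'));
    rewrite ?(inj_eq inja) 1?adj_sym // setUC.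
(* Of any two edges at [b 0] one has colour 1, so two of the three do. They form the first two edges
   of the path. *)
have [p [p' [pp' cp cp']]] : exists p p', [/\ p != p',
    c [set a p; b (inord 0)]%SET = inord 1
    & c [set a p'; b (inord 0)]%SET = inord 1].
  have d (m l : nat) : m < 3 -> l < 3 -> m != l -> inord m != inord l :> 'I_3.
    by move=> hm hl; rewrite -(inj_eq val_inj) /= !inordK.
  have := colP (inord 0) _ _ (d 0 1 isT isT isT).
  have := colP (inord 0) _ _ (d 0 2 isT isT isT).
  have := colP (inord 0) _ _ (d 1 2 isT isT isT).
  by move=> [e|e] [f|f] [g|g]; do ?[
    by exists (inord 0), (inord 1); split; rewrite ?d |
    by exists (inord 0), (inord 2); split; rewrite ?d |
    by exists (inord 1), (inord 2); split; rewrite ?d ].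
(* The last edge leaves [a p'] for one of [b 1], [b 2], so that it avoids [b 0]. *)
have [q' [q'0 cq']] : exists q', q' != inord 0 :> 'I_3 /\
    c [set a p'; b q']%SET = inord 1.
  have d12 : inord 1 != inord 2 :> 'I_3.
    by rewrite -(inj_eq val_inj) /= !inordK.
  by case: (rowP p' _ _ d12) => e;
    [exists (inord 1) | exists (inord 2)]; split;
    rewrite // -(inj_eq val_inj) /= !inordK.
have nab u v : a u == b v = false.
  by apply/negP => /eqP e; move: (ab u v); rewrite e adj_irr.
apply: no1.
apply: (@mono_copy_path4 _ _ _ _ (a p) (b (inord 0)) (a p') (b q')) => //.
- rewrite /= !inE !(inj_eq inja) !(inj_eq injb) !nab [b _ == a _]eq_sym nab.
  by rewrite (negbTE pp') eq_sym (negbTE q'0).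
- by rewrite adj_sym.
- by rewrite setUC.
Qed.

Lemma arrows_cherry_path4_matching j n : 1 < j ->
  arrows (cmultipartite j (3 * n))
    (graphs3 (cbipartite 1 2) (path_graph 4) (matching_graph n)).
Proof.
move=> hj c.
have [h0|no0] := pselect (has_mono_copy c (cbipartite 1 2) (inord 0)).
  by exists (inord 0); rewrite /graphs3 /= inordK.
have [h1|no1] := pselect (has_mono_copy c (path_graph 4) (inord 1)).
  by exists (inord 1); rewrite /graphs3 /= inordK.
exists (inord 2); rewrite /graphs3 /= inordK //.
have lt (k : 'I_n) (p : 'I_3) : 3 * k + p < 3 * n.
  by case: k p => [k hk] [p hp] /=; lia.
(* Only classes 0 and 1 are used, with [s] read as the class index. Each class is cut into [n]
   blocks of three, and blocks with equal [k] span the [k]-th [K_{3,3}]. *)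
pose V (s : bool) k p : cmultipartite j (3 * n) :=
  (Ordinal (leq_ltn_trans (leq_b1 s) hj), Ordinal (lt k p)).
have Vinj s s' k k' p p' : V s k p = V s' k' p' -> [/\ s = s', k = k' & p = p'].
  case=> es ek; have lp := ltn_ord p; have lp' := ltn_ord p'.
  have [e1 e2] : k = k' :> nat /\ p = p' :> nat by lia.
  by split; [case: s s' es => [] [] | apply: val_inj | apply: val_inj].
have edge k : {pq : 'I_3 * 'I_3 |
    c [set V false k pq.1; V true k pq.2]%SET = inord 2}.
  apply: cid; have [||p [q e]] :=
    @mono_copy_K33 _ c (V false k) (V true k) _ _ (fun _ _ => isT) no0 no1.
  - by move=> p p' /Vinj [].
  - by move=> p p' /Vinj [].
  - by exists (p, q).
exists (fun x : matching_graph n =>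
  V x.2 x.1 (if x.2 then (sval (edge x.1)).2 else (sval (edge x.1)).1)).
  by move=> [k s] [k' s'] /= /Vinj [-> ->].
move=> [k s] [k' s'] /andP[/= /eqP <-]; case: (edge k) => [[p q] /= e].
by case: s s' => [] [] // _; split; rewrite // setUC.
Qed.

Lemma not_arrows_cherry_path4_matching (H : sgraph) (v : H) n :
  #|H| <= 2 * n ->
  ~ arrows H (graphs3 (cbipartite 1 2) (path_graph 4) (matching_graph n)).
Proof.
move=> cardH /(_ (fun S => if v \in S then inord 1 else inord 2)) [].
case=> [[|[|[|//]]] h] [f injf fP].
- have /= [_] := fP (inl ord0) (inr ord0) isT.
  by case: ifP => _ /(congr1 val); rewrite /= inordK.
(* The two end edges of [P_4] are disjoint, so they cannot both contain [v]. *)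
- have e (x y : 'I_4) : @adj (path_graph 4) x y -> v \in [set f x; f y]%SET.
    by move=> /fP /= [_]; case: ifP => // _ /(congr1 val); rewrite /= inordK.
  have /= := e (inord 0) (inord 1); have /= := e (inord 2) (inord 3).
  rewrite /path_rel !inordK // => /(_ isT) + /(_ isT); rewrite !inE.
  by case/orP=> /eqP ->; rewrite !(inj_eq injf) -!(inj_eq val_inj) /= !inordK.
(* Every [x] lies on the matching edge to its partner [(x.1, ~~ x.2)], whose image has colour 2 and
   so avoids [v]. *)
- have vf x : f x != v.
    have /= := fP x (x.1, ~~ x.2).
    rewrite /matching_rel /= eqxx; case: x => k [] /= /(_ isT) [_];
    by case: ifP => [_ /(congr1 val)|]; rewrite /= ?inordK // !inE eq_sym
      => /negbT; rewrite negb_or eq_sym => /andP[].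
  have : #|codom f| < #|H|.
    apply: (@leq_trans #|H|.-1.+1); last first.
      by rewrite prednK //; apply/card_gt0P; exists v.
    rewrite ltnS -(cardC1 v); apply: subset_leq_card.
    by apply/subsetP => _ /codomP [x ->]; rewrite !inE vf.
  rewrite card_codom // card_prod card_ord card_bool.
  by move=> /leq_trans /(_ cardH); rewrite mulnC ltnn.
Qed.

(** One admissible [t] yields a least one by well-ordering, so [xget] does not return its default
    0. *)
Lemma multipartite_ramseyP j k (Gs : 'I_k -> sgraph) t :
  0 < t -> arrows (cmultipartite j t) Gs ->
  is_multipartite_ramsey j Gs (multipartite_ramsey j Gs).
Proof.
move=> t0 arr; apply: classical_sets.xgetPex.
have ex : exists s, (0 < s) && `[< arrows (cmultipartite j s) Gs >].
  by exists t; rewrite t0; apply/asboolP.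
case: (ex_minnP ex) => m /andP[m0 /asboolP mP] min; exists m; split=> // s s0 sP.
by apply: min; rewrite s0; apply/asboolP.
Qed.

Theorem theorem3 (j n : nat) (hj : 2 <= j) (hn : 2 <= n) :
  (2 * n) %/ j + 1 <=
    multipartite_ramsey j
      (graphs3 (cbipartite 1 2) (path_graph 4) (matching_graph n)).
Proof.
have n0 : 0 < 3 * n by lia.
have [] := multipartite_ramseyP n0 (arrows_cherry_path4_matching hj).
move: (multipartite_ramsey _ _) => t t0 arr _; rewrite addn1 ltnNge.
apply/negP => tle; move: arr.
(* Any vertex can be the centre of the star; [(0, 0)] exists because [j] and [t] are positive. *)
apply: (@not_arrows_cherry_path4_matching (cmultipartite j t)
  (Ordinal (ltnW hj), Ordinal t0)).
by rewrite card_prod !card_ord mulnC -leq_divRL // ltnW.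
Qed.
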